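(* Let $H$ be a graph. The following are equivalent: (i) for every $H$-free graph $G$ and every integer $\ell \ge \chi(G)+1$, the graph $G$ is $\ell$-mixing; (ii) $H$ is an induced subgraph of $P_4$ or an induced subgraph of $P_3+P_1$.
   Context: All graphs are finite and simple. A $k$-colouring of $G$ is a map $\alpha: V(G)\to\{1,\dots,k\}$ with $\alpha(u)\neq\alpha(v)$ for every edge $uv$; $\chi(G)$ is the least $k$ for which a $k$-colouring exists. The reconfiguration graph $\mathcal{R}_k(G)$ has the $k$-colourings of $G$ as vertices, two colourings being adjacent if they differ on exactly one vertex. $G$ is $k$-mixing if $\mathcal{R}_k(G)$ is connected. A graph is $H$-free if it has no induced subgraph isomorphic to $H$. $P_n$ is the path on $n$ vertices, and $G_1+G_2$ denotes the disjoint union of $G_1$ and $G_2$. *)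

(* Defs.v *)
From mathcomp Require Import all_boot.
Set Implicit Arguments. Unset Strict Implicit. Unset Printing Implicit Defensive.

Definition simple_graph (T : finType) (e : rel T) : Prop :=
  symmetric e /\ irreflexive e.

Definition proper_col (T : finType) (e : rel T) (k : nat) (a : {ffun T -> 'I_k}) : bool :=
  [forall u, forall v, e u v ==> (a u != a v)].

Definition colourable (T : finType) (e : rel T) (k : nat) : bool :=
  [exists a : {ffun T -> 'I_k}, proper_col e a].

(* chromatic number: least k <= #|T| admitting a k-colouring
   (a simple graph always has a #|T|-colouring) *)
Definition chi (T : finType) (e : rel T) : nat :=
  find (colourable e) (iota 0 #|T|.+1).

Definition recol_adj (T : finType) (e : rel T) (k : nat) : rel {ffun T -> 'I_k} :=
  fun a b => [&& proper_col e a, proper_col e b & #|[set v | a v != b v]| == 1].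

Definition mixing (T : finType) (e : rel T) (k : nat) : Prop :=
  forall a b : {ffun T -> 'I_k}, proper_col e a -> proper_col e b ->
    connect (@recol_adj T e k) a b.

Definition induced_sub (TH : finType) (eH : rel TH) (TG : finType) (eG : rel TG) : Prop :=
  exists f : TH -> TG, injective f /\ forall x y, eH x y = eG (f x) (f y).

Definition H_free (TH : finType) (eH : rel TH) (TG : finType) (eG : rel TG) : Prop :=
  ~ induced_sub eH eG.

Definition path_rel (n : nat) : rel 'I_n :=
  fun i j => (i.+1 == j :> nat) || (j.+1 == i :> nat).

Definition union_rel (T1 T2 : finType) (e1 : rel T1) (e2 : rel T2) : rel (T1 + T2)%type :=
  fun x y => match x, y with
             | inl a, inl b => e1 a b
             | inr a, inr b => e2 a b
             | _, _ => false
             end.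

Definition P3P1 : rel ('I_3 + 'I_1)%type := union_rel (@path_rel 3) (@path_rel 1).

(* Main.v *)
(* Call a set A of vertices reducible if every colouring of G[A] can be recoloured,
   using only its own colours, into one with as few colours as any given colouring
   of G[A]. If all sets are reducible then one spare colour connects everything:
   take a class X of an optimal target colouring, give X a fresh colour, reduce the
   rest, move X to its final colour and recurse on the complement of X.
   Reducibility passes to disjoint unions and joins, and holds for 3K1-free sets:
   when a uses more colours than b, some a-class is a singleton {u}; recolour the
   b-class of u with a(u), delete that class and recurse. A P4-free or (P3+P1)-free
   set is disconnected, co-disconnected or 3K1-free.
   Conversely H must be an induced subgraph of every non-mixing example: C6 with its
   frozen 3-colouring forces H into C6, and a 2K2-free 4-colourable graph on 10
   vertices with a frozen 5-colouring makes H 2K2-free, which leaves only induced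
   subgraphs of P4 and P3+P1. *)
Require Import Defs.
From mathcomp Require Import all_boot.
From mathcomp Require Import zify.
Set Implicit Arguments. Unset Strict Implicit. Unset Printing Implicit Defensive.

(** * Recolouring inside a set of vertices *)

Section Recolouring.

Variables (T K : finType) (e : rel T).
Hypothesis e_sym : symmetric e.
Implicit Types (A B X : {set T}) (C D E : {set K}) (a b : {ffun T -> K}).

(** Colourings stay total functions, so that one function serves all the vertex sets and palettes
    met in the recursions. *)
Definition col A C a : Prop :=
  {in A, forall x, a x \in C} /\ {in A &, forall x y, e x y -> a x != a y}.

(** A step may change nothing, and only the colourings after the first are required to be proper. *)
Inductive reach A C a : {ffun T -> K} -> Prop :=
| reach_refl : reach A C a a
| reach_step b c v : reach A C a b -> col A C c -> v \in A ->
    (forall x, x != v -> b x = c x) -> reach A C a c.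

Lemma col_sub A B C D a :
  B \subset A -> C \subset D -> col A C a -> col B D a.
Proof.
move=> /subsetP sBA /subsetP sCD [aC aP]; split=> [x /sBA /aC /sCD //|].
by move=> x y /sBA xA /sBA yA; apply: aP.
Qed.

Lemma col_eq A C a b : {in A, a =1 b} -> col A C a -> col A C b.
Proof.
move=> ab [aC aP]; split=> [x xA|x y xA yA]; first by rewrite -ab ?aC.
by rewrite -!ab //; apply: aP.
Qed.

Lemma reach_col A C a b : col A C a -> reach A C a b -> col A C b.
Proof. by move=> aP; case. Qed.

Lemma reach_out A C a b : reach A C a b -> forall x, x \notin A -> a x = b x.
Proof.
elim=> // {}b c v _ IH _ vA bc x xA; rewrite IH // bc //.
by apply: contraNneq xA => ->.
Qed.

Lemma reach_trans A C a b c : reach A C a b -> reach A C b c -> reach A C a c.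
Proof. by move=> ab; elim=> // {}c d v _ ac dP vA; apply: reach_step ac dP vA. Qed.

Lemma reach_sym A C a b : col A C a -> reach A C a b -> reach A C b a.
Proof.
move=> aP; elim=> [|{}b c v ab ba cP vA bc]; first exact: reach_refl.
apply: reach_trans ba; apply: (reach_step (reach_refl _ _ _) _ vA).
  exact: reach_col ab.
by move=> x xv; rewrite bc.
Qed.

(** Vertices of [A :\: B] keep their colours, and those next to [B] are coloured outside [D], so
    steps on [B] that use only [D] never create a conflict. *)
Lemma reach_ext A B C D a b :
    B \subset A -> D \subset C -> col A C a ->
    {in B & A :\: B, forall x y, e x y -> a y \notin D} ->
  reach B D a b -> reach A C a b.
Proof.
move=> sBA sDC aP aD; elim=> [|{}b c v ab IH cP vB bc]; first exact: reach_refl.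
apply: (reach_step IH _ (subsetP sBA _ vB) bc).
have ac x : x \notin B -> a x = c x by move/(reach_out (reach_step ab cP vB bc)).
have cross x y : x \in B -> y \in A -> y \notin B -> e x y -> c x != c y.
  move=> xB yA yB exy; rewrite -[c y]ac //.
  apply: contraNneq (aD x y xB _ exy) => [<-|]; first exact: cP.1.
  by rewrite inE yB.
split=> [x xA|x y xA yA exy].
  have [xB|xB] := boolP (x \in B); first by rewrite (subsetP sDC) ?cP.1.
  by rewrite -ac ?aP.1.
have [xB|xB] := boolP (x \in B); have [yB|yB] := boolP (y \in B).
- exact: cP.2.
- exact: cross.
- by rewrite eq_sym cross // e_sym.
- by rewrite -!ac ?aP.2.
Qed.

Lemma reach_sub A C D a b : D \subset C -> reach A D a b -> reach A C a b.
Proof.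
move=> sDC; elim=> [|{}b c v _ IH cP vA bc]; first exact: reach_refl.
by apply: (reach_step IH _ vA bc); apply: col_sub cP.
Qed.

Definition recol a X f : {ffun T -> K} := [ffun x => if x \in X then f else a x].

Lemma recol_col A C a X f :
    col A C a -> f \in C -> X \subset A -> {in X &, forall x y, ~~ e x y} ->
    {in X & A :\: X, forall x y, e x y -> a y != f} ->
  col A C (recol a X f).
Proof.
move=> aP fC sXA Xind Xf; split=> [x xA|x y xA yA exy]; rewrite !ffunE.
  by case: ifP => // _; apply: aP.1.
case: ifP => xX; case: ifP => yX.
- by move: (Xind x y xX yX); rewrite exy.
- by rewrite eq_sym (Xf x) // inE yX.
- by rewrite (Xf y) // ?inE ?xX // e_sym.
- exact: aP.2.
Qed.

(** The vertices of [X] can be moved one by one: they are pairwise non-adjacent, and no neighbour in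
    [A :\: X] has colour [f]. *)
Lemma recol_reach A C a X f :
    col A C a -> f \in C -> X \subset A -> {in X &, forall x y, ~~ e x y} ->
    {in X & A :\: X, forall x y, e x y -> a y != f} ->
  reach A C a (recol a X f).
Proof.
move=> aP fC; have [n] := ubnP #|X|; elim: n X => // n IH X /ltnSE-leXn sXA Xind Xf.
have [X0|[v vX]] := set_0Vmem X.
  suff -> : recol a X f = a by exact: reach_refl.
  by apply/ffunP=> x; rewrite ffunE X0 inE.
have XvX x : x \in X :\ v -> x \in X by rewrite inE => /andP[].
apply: (@reach_step _ _ _ (recol a (X :\ v) f) _ v).
- apply: IH.
  + by apply: leq_trans leXn; rewrite [leqRHS](cardsD1 v) vX.
  + by apply/subsetP=> x /XvX; apply: (subsetP sXA).
  + by move=> x y /XvX xX /XvX; apply: Xind.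
  + move=> x y /XvX xX; rewrite !inE negb_and negbK => /andP[yvX yA] exy.
    have [yX|yX] := boolP (y \in X).
      by move: (Xind x y xX yX); rewrite exy.
    by apply: Xf xX _ exy; rewrite inE yX.
- exact: recol_col.
- exact: (subsetP sXA).
- by move=> x xv; rewrite !ffunE !inE xv.
Qed.

(* Classes are moved one at a time to colours of [E] that are not in use. *)
Lemma reach_rename A C D E a :
    col A D a -> D \subset C -> E \subset C -> #|D| <= #|E| ->
  exists2 b, reach A C a b & col A E b.
Proof.
have [n] := ubnP #|D :\: E|; elim: n D a => // n IH D a /ltnSE-leDn aP sDC sEC leDE.
have [/eqP|[c]] := set_0Vmem (D :\: E).
  rewrite setD_eq0 => sDE; exists a; first exact: reach_refl.
  exact: col_sub aP.
rewrite inE => /andP[cE cD].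
have [d] : exists d, d \in E :\: D.
  apply/card_gt0P; rewrite cardsD subn_gt0 setIC.
  apply: leq_trans leDE; apply: proper_card; rewrite properE subsetIl.
  by apply/subsetPn; exists c => //; rewrite inE cD.
rewrite inE => /andP[dD dE].
pose X := [set x in A | a x == c].
have sXA : X \subset A by apply/subsetP=> x; rewrite inE => /andP[].
have Xind : {in X &, forall x y, ~~ e x y}.
  move=> x y; rewrite !inE => /andP[xA /eqP ax] /andP[yA /eqP ay].
  by apply/negP=> /(aP.2 x y xA yA); rewrite ax ay eqxx.
have Xd x y : x \in X -> y \in A :\: X -> e x y -> a y != d.
  move=> _; rewrite inE => /andP[_ /aP.1 ayD] _.
  by apply: contraNneq dD => <-.
have aC := col_sub (subxx A) sDC aP; have dC := subsetP sEC _ dE.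
have a1 := recol_reach aC dC sXA Xind Xd.
have a1D : col A (d |: D :\ c) (recol a X d).
  split=> [x xA|]; last exact: (reach_col aC a1).2.
  rewrite ffunE !inE xA /=; case: ifP => [|->]; first by rewrite eqxx.
  by rewrite aP.1 ?orbT.
have [||||b a1b bE] := IH _ _ _ a1D.
- apply: leq_trans leDn; apply: proper_card; rewrite properE.
  apply/andP; split; last by apply/subsetPn; exists c; rewrite ?inE ?cE ?eqxx ?orbF //;
    apply: contraNneq cE => ->.
  apply/subsetP=> x; rewrite !inE => /andP[xE /orP[/eqP xd|/andP[_ ->]]].
    by rewrite xd dE in xE.
  by rewrite xE.
- by rewrite subUset sub1set dC (subset_trans (subsetDl _ _) sDC).
- by [].
- rewrite cardsU1 !inE (negPf dD) andbF /= (leq_trans _ leDE) //.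
  by rewrite [leqRHS](cardsD1 c) cD.
by exists b => //; apply: reach_trans a1b.
Qed.

Definition reducible A : Prop := forall C D a b, col A C a -> col A D b ->
  exists E a', [/\ E \subset C, #|E| <= #|D|, reach A C a a' & col A E a'].

(** Reducibility leaves the final palette open; renaming classes then moves it into any prescribed
    [E] that is large enough. *)
Lemma reducible_into A C D E a b :
    reducible A -> col A C a -> col A D b -> E \subset C -> #|D| <= #|E| ->
  exists2 a', reach A C a a' & col A E a'.
Proof.
move=> redA aP bP sEC leDE; have [F [a1 [sFC leFD a1r a1P]]] := redA C D a b aP bP.
have [a2 a2r a2P] := reach_rename a1P sFC sEC (leq_trans leFD leDE).
by exists a2 => //; apply: reach_trans a2r.
Qed.

Lemma subset_of_card C n : n <= #|C| -> exists2 E : {set K}, E \subset C & #|E| = n.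
Proof.
elim: n => [|n IH] nC; first by exists set0; rewrite ?sub0set ?cards0.
have [E sEC En] := IH (ltnW nC).
have [x] : exists x, x \in C :\: E.
  by apply/card_gt0P; rewrite cardsDS // subn_gt0 En.
rewrite inE => /andP[xE xC]; exists (x |: E); last by rewrite cardsU1 xE En.
by rewrite subUset sub1set xC.
Qed.

Lemma reducible_mixing A C D a b d :
    (forall B, reducible B) -> col A C a -> col A C b ->
    (forall x, x \notin A -> a x = b x) -> col A D d -> #|D| < #|C| ->
  reach A C a b.
Proof.
move=> red; have [n] := ubnP #|A|.
elim: n A C D a b d => // n IH A C D a b d /ltnSE-leAn aP bP ab dP ltDC.
have [E [b1 [sEC leED bb1 b1P]]] := red A C D b d bP dP.
have [F [a1 [sFC leFD aa1 a1P]]] := red A C D a d aP dP.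
have b1C := reach_col bP bb1; have a1C := reach_col aP aa1.
suff a1b1 : reach A C a1 b1.
  by apply: reach_trans aa1 (reach_trans a1b1 (reach_sym bP bb1)).
have out1 x : x \notin A -> a1 x = b1 x.
  by move=> xA; rewrite -(reach_out aa1) // -(reach_out bb1) // ab.
have [A0|[x0 x0A]] := set_0Vmem A.
  suff -> : a1 = b1 by exact: reach_refl.
  by apply/ffunP=> x; rewrite out1 // A0 inE.
pose c := b1 x0; pose X := [set x in A | b1 x == c].
have cE : c \in E := b1P.1 _ x0A.
have cC := subsetP sEC _ cE.
have sXA : X \subset A by apply/subsetP=> x; rewrite inE => /andP[].
have Xind : {in X &, forall x y, ~~ e x y}.
  move=> x y; rewrite !inE => /andP[xA /eqP ax] /andP[yA /eqP ay].
  by apply/negP=> /(b1P.2 x y xA yA); rewrite ax ay eqxx.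
(* [a1] uses at most [#|D| < #|C|] colours, so some [f] is free for [X]. *)
have [f] : exists f, f \in C :\: F.
  by apply/card_gt0P; rewrite cardsDS // subn_gt0 (leq_ltn_trans leFD).
rewrite inE => /andP[fF fC].
have Xf x y : x \in X -> y \in A :\: X -> e x y -> a1 y != f.
  by move=> _; rewrite inE => /andP[_ /a1P.1 ay] _; apply: contraNneq fF => <-.
pose a2 := recol a1 X f.
have a12 : reach A C a1 a2 by apply: recol_reach.
have a2C := reach_col a1C a12.
pose B := A :\: X.
have sBA : B \subset A by apply: subsetDl.
have a2B : col B (C :\ f) a2.
  split=> [x|]; last exact: (col_sub sBA (subxx _) a2C).2.
  rewrite inE => /andP[xX xA]; rewrite ffunE (negPf xX) !inE a1C.1 // andbT.
  by apply: contraNneq fF => <-; apply: a1P.1.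
have b1B (G : {set K}) : E \subset G -> col B (G :\ c) b1.
  move=> sEG; split=> [x|]; last exact: (col_sub sBA (subxx _) b1P).2.
  rewrite !inE => /andP[]; rewrite negb_and => /orP[/negP//|-> xA].
  by rewrite (subsetP sEG) // b1P.1.
(* Possibly [f] equals [c], and then [C] loses only one colour. *)
have cardE : #|E :\ c| <= #|C :\ f :\ c|.
  have := leq_ltn_trans leED ltDC; rewrite (cardsD1 c E) cE (cardsD1 f C) fC.
  by rewrite (cardsD1 c (C :\ f)) !inE cC; case: (c == f) => /=; lia.
have [a3 a23 a3B] :=
  reducible_into (red B) a2B (b1B E (subxx _)) (subsetDl _ _) cardE.
have out23 x : x \in X -> a3 x = f.
  by move=> xX; rewrite -(reach_out a23) ?ffunE ?xX // inE xX.
have AB x : x \in A -> (x \in B) = (x \notin X) by move=> xA; rewrite inE xA andbT.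
have r23 : reach A C a2 a3.
  apply: reach_ext a23 => //; first exact: subsetDl.
  move=> x y _; rewrite inE => /andP[yB yA] _.
  by move: yB; rewrite AB // negbK => yX; rewrite ffunE yX !inE eqxx.
have a3C := reach_col a2C r23.
pose a4 := recol a3 X c.
have r34 : reach A C a3 a4.
  apply: recol_reach => // x y _ yB _.
  by have := a3B.1 y yB; rewrite !inE => /andP[].
have a4C := reach_col a3C r34.
(* [X] now has its final colour [c], which [B] avoids. Recursing with the palettes [C :\ c] and
   [E :\ c] keeps the strict inequality; [b1] is both target and reference colouring. *)
have r4 : reach B (C :\ c) a4 b1.
  apply: (IH _ _ (E :\ c) _ _ b1); last 5 first.
  - split=> [x|]; last exact: (col_sub sBA (subxx _) a4C).2.
    move=> xB; have := a3B.1 x xB; move: xB; rewrite !inE => /andP[/negPf xX xA].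
    by rewrite ffunE inE xX => /and3P[-> _ ->].
  - exact: b1B.
  - move=> x; rewrite inE negb_and negbK => /orP[xX|xA]; rewrite ffunE.
      by rewrite xX; move: xX; rewrite inE => /andP[_ /eqP].
    rewrite -out1 // ifN; last by apply: contra xA; apply: (subsetP sXA).
    rewrite -(reach_out a23) ?ffunE.
      by rewrite ifN //; apply: contra xA; apply: (subsetP sXA).
    by apply: contra xA; apply: (subsetP sBA).
  - exact: b1B.
  - have := leq_ltn_trans leED ltDC.
    by rewrite (cardsD1 c E) cE (cardsD1 c C) cC.
  apply: leq_trans leAn; apply: proper_card; rewrite properE sBA.
  by apply/subsetPn; exists x0 => //; rewrite !inE x0A eqxx.
apply: (reach_trans a12); apply: (reach_trans r23); apply: (reach_trans r34).
apply: reach_ext r4 => //; first exact: subsetDl.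
move=> x y _; rewrite inE => /andP[yB yA] _.
by move: yB; rewrite AB // negbK => yX; rewrite ffunE yX !inE eqxx.
Qed.

End Recolouring.

(** * Decomposition of P4-free and (P3+P1)-free graphs *)

Section Disconnection.

Variable T : finType.
Implicit Types (r : rel T) (A B : {set T}).

(** Taken for any relation, since [disc (co r) A] says that [A] induces a join. *)
Definition disc r A := [exists B : {set T},
  [&& B \subset A, B != set0, B != A &
      [forall x in B, forall y in A :\: B, ~~ r x y]]].

Definition co r : rel T := fun x y => (x != y) && ~~ r x y.

Lemma discP r A :
  reflect (exists B, [/\ B \subset A, B != set0, B != A &
                        {in B & A :\: B, forall x y, ~~ r x y}])
          (disc r A).
Proof.
apply: (iffP existsP) => -[B].
  case/and4P=> sBA B0 BA /forall_inP rB; exists B; split=> // x y xB.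
  by move: y; apply/forall_inP/rB.
case=> sBA B0 BA rB; exists B; rewrite sBA B0 BA /=.
by apply/forall_inP=> x xB; apply/forall_inP=> y; apply: rB.
Qed.

(** An induction principle for connected sets: a property that holds somewhere and spreads along
    edges holds everywhere. *)
Lemma not_disc r A B x : ~~ disc r A -> B \subset A -> x \in B ->
  {in B & A, forall y z, r y z -> z \in B} -> B = A.
Proof.
move=> /discP nd sBA xB cl; apply/eqP/negPn/negP=> BA; apply: nd.
exists B; split=> //; first by apply/set0Pn; exists x.
move=> y z yB; rewrite inE => /andP[zB zA].
by apply: contra zB; apply: cl yB zA.
Qed.

Lemma co_sym r : symmetric r -> symmetric (co r).
Proof. by move=> rs x y; rewrite /co eq_sym rs. Qed.

Lemma coK r : irreflexive r -> co (co r) =2 r.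
Proof.
by move=> ri x y; rewrite /co; case: eqVneq => [->|_] /=; rewrite ?ri ?negbK.
Qed.

Lemma eq_disc r r' A : r =2 r' -> disc r A = disc r' A.
Proof.
move=> rr; apply: eq_existsb => B; do 3!congr (_ && _).
by apply: eq_forallb => x; congr (_ ==> _); apply: eq_forallb => y; rewrite rr.
Qed.

(** In a simple graph the listed edges and non-edges force four distinct vertices; in [P3P1_free]
    the ends [a] and [c] are separated explicitly. *)
Definition P4_free r := forall a b c d, r a b -> r b c -> r c d ->
  ~~ r a c -> ~~ r a d -> ~~ r b d -> False.

Definition P3P1_free r := forall a b c d, r a b -> r b c -> a != c ->
  ~~ r a c -> ~~ r d a -> ~~ r d b -> ~~ r d c -> False.

(** P4 is self-complementary: the complement of the path [a b c d] is the path [b d a c]. *)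
Lemma co_P4_free r : symmetric r -> irreflexive r -> P4_free r -> P4_free (co r).
Proof.
move=> rs ri P4 a b c d /andP[ab rab] /andP[bc rbc] /andP[cd rcd] nac nad nbd.
have ac : a != c by apply: contraNneq nad => ->; rewrite /co cd.
have bd : b != d by apply: contraNneq nad => <-; rewrite /co ab.
have ad : a != d by apply: contraNneq nac => ->; rewrite /co eq_sym cd rs.
move: nac nad nbd; rewrite /co ac bd ad /= !negbK => rac rad rbd.
by apply: (P4 b d a c) => //; rewrite rs.
Qed.

(** If [v] sees all of [A], it splits off in the complement. Otherwise let [C] be the side of a
    non-neighbour [u]. If [v |: A] were connected, [v] would have a neighbour [w] on the other side,
    and the non-neighbours of [v] in [C] would be closed under adjacency, which is absurd. *)
Lemma disc_add_vertex r A v : symmetric r -> irreflexive r -> P4_free r ->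
  v \notin A -> disc r A -> disc r (v |: A) || disc (co r) (v |: A).
Proof.
move=> rs ri P4 vA /discP[B [sBA B0 BA rB]].
have [/forall_inP rvA|/forall_inPn[u uA nvu]] :=
    boolP [forall x in A, r v x].
  apply/orP; right; apply/discP; exists [set v]; split.
  - by rewrite sub1set !inE eqxx.
  - by apply/set0Pn; exists v; rewrite inE.
  - have [x xB] := set0Pn _ B0; have xA := subsetP sBA _ xB.
    apply/eqP=> /setP/(_ x); rewrite !inE xA orbT => /eqP xv.
    by rewrite -xv xA in vA.
  - move=> x y; rewrite !inE => /eqP-> /andP[/negPf-> /= yA].
    by rewrite /co rvA // andbF.
suff main (C : {set T}) : C \subset A -> C != A -> u \in C ->
    {in C & A :\: C, forall x y, ~~ r x y} -> disc r (v |: A).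
  apply/orP; left; have [uB|uB] := boolP (u \in B); first exact: (main B).
  apply: (main (A :\: B)); rewrite ?subsetDl ?inE ?uA ?uB //.
    apply: contraNneq B0 => AB; apply/eqP/setP=> x; rewrite inE.
    apply/negbTE/negP=> xB.
    by have := subsetP sBA _ xB; rewrite -AB inE xB.
  move=> x y xAB; rewrite !inE negb_and negbK => /andP[/orP[yB|/negPf->//] yA].
  by rewrite rs; apply: rB.
move=> sCA CA uC rC; have [//|nd] := boolP (disc r _).
have vvA : v \in v |: A by rewrite !inE eqxx.
have [z zA zC] : exists2 z, z \in A & z \notin C.
  by apply/subsetPn; move: CA; rewrite eqEsubset sCA.
have [w wAC rvw] : exists2 w, w \in A :\: C & r v w.
  apply/exists_inP; have [//|/exists_inPn nw] := boolP [exists w in A :\: C, r v w].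
  suff eAC : (A :\: C)  = v |: A.
    by move: vvA; rewrite -eAC inE (negPf vA) andbF.
  apply: (not_disc (x := z) nd); rewrite ?inE ?zA ?zC //.
    by rewrite (subset_trans (subsetDl _ _)) // subsetUr.
  move=> x y xAC; rewrite !inE => /orP[/eqP-> rxv|yA rxy].
    by have := nw x xAC; rewrite rs rxv.
  by rewrite yA andbT; apply/negP=> yC; have := rC y x yC xAC; rewrite rs rxy.
pose W := [set x in C | ~~ r v x].
suff WA : W = v |: A.
  by move: vvA; rewrite -WA inE => /andP[/(subsetP sCA)]; rewrite (negPf vA).
apply: (not_disc (x := u) nd); rewrite ?inE ?uC //.
  by apply/subsetP=> x; rewrite !inE => /andP[/(subsetP sCA)-> _]; rewrite orbT.
move=> x y; rewrite !inE => /andP[xC nvx] /orP[/eqP-> rxv|yA rxy].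
  by rewrite rs rxv in nvx.
have yC : y \in C.
  by apply/negPn/negP=> yC; have := rC x y xC; rewrite inE yC yA rxy => /(_ isT).
rewrite yC; apply/negP=> rvy.
(* Otherwise [x y v w] is an induced P4. *)
by apply: (P4 x y v w); rewrite 1?[r y v]rs 1?[r x v]rs // rC.
Qed.

(** Seinsche's theorem on cographs, adding one vertex at a time; if the smaller set is a join, the
    step is applied to [co r]. *)
Lemma P4_free_disc r A : symmetric r -> irreflexive r -> P4_free r ->
  1 < #|A| -> disc r A || disc (co r) A.
Proof.
move=> rs ri P4; have [n] := ubnP #|A|.
elim: n A => // n IH A /ltnSE-leAn A1.
have [v vA] : exists v, v \in A by apply/card_gt0P; apply: ltnW.
have cA : #|A| = #|A :\ v|.+1 by rewrite (cardsD1 v A) vA.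
have vA' : v \notin A :\ v by rewrite !inE eqxx.
rewrite -(setD1K vA).
have [A'1|A'1] := ltnP 1 #|A :\ v|.
  have /orP[dA|dA] := IH _ (leq_trans (eq_leq (esym cA)) leAn) A'1.
    exact: disc_add_vertex dA.
  have := disc_add_vertex (co_sym rs) _ (co_P4_free rs ri P4) vA' dA.
  rewrite (eq_disc _ (coK ri)) orbC; apply=> x.
  by rewrite /co eqxx.
have /cards1P[u Au] : #|A :\ v| == 1 by rewrite eqn_leq A'1 -ltnS -cA.
have uv : u != v by have := set11 u; rewrite -Au !inE => /andP[].
have one q : ~~ q v u -> disc q (v |: A :\ v).
  move=> qvu; rewrite Au; apply/discP; exists [set v]; split.
  - by rewrite sub1set !inE eqxx.
  - by apply/set0Pn; exists v; rewrite inE.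
  - by apply/eqP=> /setP/(_ u); rewrite !inE eqxx orbT (negPf uv).
  - by move=> x y; rewrite !inE => /eqP-> /andP[/negPf-> /= /eqP->].
have [rvu|rvu] := boolP (r v u); last by rewrite one.
by rewrite (one (co r)) ?orbT // /co rvu andbF.
Qed.

(* The complement of a triple-free set is triangle-free; this is Olariu's theorem
   on paw-free graphs, read in the complement: in [co r] every edge lies in a
   triangle and then dominates. *)
Lemma P3P1_free_disc r A : symmetric r -> irreflexive r -> P3P1_free r ->
  [\/ disc r A, disc (co r) A |
    {in A & A & A, forall x y z, ~~ [&& co r x y, co r y z & co r x z]}].
Proof.
move=> rs ri P31.
have [|ndr] := boolP (disc r A); first by constructor 1.
have [|ndh] := boolP (disc (co r) A); first by constructor 2.
constructor 3 => x0 y0 z0 x0A y0A z0A; apply/negP=> /and3P[hxy hyz hxz].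
set h := co r in ndh hxy hyz hxz.
have hs : symmetric h := co_sym rs.
have hn x y : h x y -> ~~ r x y by case/andP.
have nhr x y : x != y -> ~~ h x y -> r x y by rewrite /h /co => ->; rewrite negbK.
have hne x y : h x y -> x != y by case/andP.
(* If [v] met the triangle [t a b] of [h] only in [t], then [a v b] would be an induced P3 of [r]
   and [t] isolated from it. *)
have paw t a b v : h t a -> h a b -> h t b -> h v t -> v != a -> v != b ->
    h v a || h v b.
  move=> ta ab tb vt va vb; apply/negPn/negP; rewrite negb_or => /andP[nva nvb].
  have rav : r a v by rewrite rs nhr.
  have tv : h t v by rewrite hs.
  by apply: (P31 a v b t rav (nhr _ _ vb nvb) (hne _ _ ab)); apply: hn.
pose intri x := [exists y in A, exists z in A, [&& h x y, h y z & h x z]].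
have triP x y z : y \in A -> z \in A -> h x y -> h y z -> h x z -> intri x.
  move=> yA zA xy yz xz; apply/exists_inP; exists y => //.
  by apply/exists_inP; exists z; rewrite ?xy ?yz.
have edge_tri t v : t \in A -> intri t -> h v t ->
    exists2 s, s \in A & h v s && h t s.
  move=> tA /exists_inP[a aA /exists_inP[b bA /and3P[ta ab tb]]] vt.
  have [->|va] := eqVneq v a; first by exists b; rewrite ?ab.
  have [->|vb] := eqVneq v b; first by exists a; rewrite // hs ab.
  by case/orP: (paw t a b v ta ab tb vt va vb) => [v_a|v_b];
    [exists a; rewrite ?v_a|exists b; rewrite ?v_b].
(* Lying in a triangle spreads along the edges of [h], which is connected on [A]. *)
have allT : [set x in A | intri x] = A.
  apply: (not_disc (x := x0) ndh).
  - by apply/subsetP=> x; rewrite inE => /andP[].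
  - by rewrite inE x0A (triP _ y0 z0).
  - move=> t v; rewrite !inE -/h => /andP[tA tt] vA tv; rewrite vA.
    have vt : h v t by rewrite hs.
    have [s sA /andP[vs ts]] := edge_tri t v tA tt vt.
    exact: (triP v t s).
have tri t v : t \in A -> h v t -> exists2 s, s \in A & h v s && h t s.
  by move=> tA; apply: edge_tri => //; move: tA; rewrite -{1}allT inE => /andP[].
(* Complete [y t] to a triangle [y t s]. If [v] misses [y], it sees both [t] and [s]; as [z] sees
   one of these, that one forms a triangle with [y] and [z], and [paw] applies to [v]. *)
have step y z t v : y \in A -> t \in A -> h y z -> h t y -> h v t -> h v y || h v z.
  move=> yA tA yz ty vt; have yt : h y t by rewrite hs.
  have zy : h z y by rewrite hs.
  have [->|vy] := eqVneq v y; first by rewrite yz orbT.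
  have [->|vz] := eqVneq v z; first by rewrite zy.
  have [s sA /andP[ts ys]] := tri y t yA ty.
  have [->|vs] := eqVneq v s; first by rewrite [h s y]hs ys.
  have /orP[->//|v_s] := paw t y s v ty ys ts vt vy vs.
  have [->|zt] := eqVneq z t; first by rewrite vt orbT.
  have [->|zs] := eqVneq z s; first by rewrite v_s orbT.
  have /orP[z_t|z_s] := paw y t s z yt ts ys zy zt zs.
    by apply: (paw t); rewrite // hs.
  by apply: (paw s); rewrite // hs.
have dom y z x : y \in A -> z \in A -> h y z -> x \in A -> h x y || h x z.
  move=> yA zA yz xA; have zy : h z y by rewrite hs.
  suff NA : [set x in A | h x y || h x z] = A.
    by move: xA; rewrite -{1}NA inE => /andP[].
  apply: (not_disc (x := y) ndh).
  - by apply/subsetP=> w; rewrite inE => /andP[].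
  - by rewrite inE yA yz orbT.
  - move=> t v; rewrite !inE => /andP[tA tyz] vA tv; rewrite vA /=.
    have vt : h v t by rewrite hs.
    case/orP: tyz => [ty|tz].
      exact: (step y z t).
    by rewrite orbC; apply: (step z y t).
(* By [dom], [h] is complete multipartite on [A], so the part of [x0] is closed under [r]; since [r]
   is connected on [A], that part is all of [A]. *)
suff BA : [set w in A | ~~ h x0 w] = A.
  by move: y0A; rewrite -BA inE hxy andbF.
apply: (not_disc (x := x0) ndr).
- by apply/subsetP=> x; rewrite inE => /andP[].
- by rewrite inE x0A /h /co eqxx.
- move=> w w'; rewrite !inE => /andP[wA nw] w'A rww'; rewrite w'A /=.
  apply/negP=> xw'; have := dom _ _ w x0A w'A xw' wA.
  by rewrite hs (negPf nw) /h /co rww' andbF.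
Qed.

End Disconnection.

(** * Reducibility *)

Section Reducibility.

Variables (T K : finType) (e : rel T).
Hypotheses (e_sym : symmetric e) (e_irr : irreflexive e).
Implicit Types (A B X : {set T}) (C D E : {set K}) (a b : {ffun T -> K}).

(** Without edges between the parts, both can be moved into one common palette of size [#|D|]. *)
Lemma reducible_union A : disc e A ->
  (forall B, B \proper A -> reducible K e B) -> reducible K e A.
Proof.
move=> /discP[B [sBA B0 BA eB]] red C D a b aP bP.
have redB : reducible K e B by apply: red; rewrite properEneq BA.
have redA : reducible K e (A :\: B).
  apply: red; rewrite properE subsetDl; apply/subsetPn.
  by have [x xB] := set0Pn _ B0; exists x; rewrite ?(subsetP sBA) // inE xB.
have [leCD|/ltnW ltDC] := leqP #|C| #|D|.
  by exists C, a; split=> //; apply: reach_refl.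
have [E sEC cE] := subset_of_card ltDC; have leDE := eq_leq (esym cE).
have sub := @col_sub T K e.
have [a1 r1 a1E] := reducible_into e_sym redB (sub _ _ _ _ _ sBA (subxx _) aP)
  (sub _ _ _ _ _ sBA (subxx _) bP) sEC leDE.
have R1 : reach e A C a a1.
  by apply: reach_ext r1 => // x y xB yB; rewrite (negPf (eB x y xB yB)).
have a1C := reach_col aP R1; have sDA := subsetDl A B.
have [a2 r2 a2E] := reducible_into e_sym redA (sub _ _ _ _ _ sDA (subxx _) a1C)
  (sub _ _ _ _ _ sDA (subxx _) bP) sEC leDE.
have no x y : x \in A :\: B -> y \in A :\: (A :\: B) -> ~~ e x y.
  rewrite !inE negb_and negbK => /andP[xB xA] /andP[/orP[yB|/negPf->//] yA].
  by rewrite e_sym eB // inE xB.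
have R2 : reach e A C a1 a2.
  by apply: reach_ext r2 => // x y xB yB; rewrite (negPf (no x y xB yB)).
exists E, a2; split; rewrite ?cE //; first exact: reach_trans R2.
have a2C := reach_col a1C R2; split=> [x xA|]; last exact: a2C.2.
have [xB|xB] := boolP (x \in B); last by apply: a2E.1; rewrite inE xB.
by rewrite -(reach_out r2) ?inE ?xB //; apply: a1E.1.
Qed.

(** In a join the parts have disjoint sets of colours. Each is reduced within its own colours, and
    the bounds add up because [b] also separates the parts. *)
Lemma reducible_join A : disc (co e) A ->
  (forall B, B \proper A -> reducible K e B) -> reducible K e A.
Proof.
move=> /discP[B [sBA B0 BA eB]] red C D a b aP bP.
have redB : reducible K e B by apply: red; rewrite properEneq BA.
have redA : reducible K e (A :\: B).
  apply: red; rewrite properE subsetDl; apply/subsetPn.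
  by have [x xB] := set0Pn _ B0; exists x; rewrite ?(subsetP sBA) // inE xB.
have sDA := subsetDl A B.
have full x y : x \in B -> y \in A :\: B -> e x y.
  move=> xB yB; have := eB x y xB yB; rewrite negb_and !negbK => /orP[/eqP xy|//].
  by move: yB; rewrite -xy inE xB.
have dis c F : col e A F c -> {in B & A :\: B, forall x y, c x != c y}.
  move=> cP x y xB yB; apply: cP.2; first exact: (subsetP sBA).
    exact: (subsetP sDA).
  exact: full.
have im c F X : X \subset A -> col e A F c -> col e X (c @: X) c /\ c @: X \subset F.
  move=> sXA cP; split; last first.
    by apply/subsetP=> _ /imsetP[x /(subsetP sXA) xA ->]; apply: cP.1.
  by split=> [x xX|]; [apply: imset_f | apply: (col_sub sXA (subxx _) cP).2].
have [aB sB] := im _ _ _ _ sBA aP; have [bB sbB] := im _ _ _ _ sBA bP.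
have [aA sA] := im _ _ _ _ sDA aP; have [bA sbA] := im _ _ _ _ sDA bP.
have [E1 [a1 [sE1 leE1 r1 a1E]]] := redB _ _ _ _ aB bB.
have R1 : reach e A C a a1.
  apply: reach_ext r1 => // x y xB yB _.
  by apply/imsetP=> -[z zB /eqP]; rewrite eq_sym (negPf (dis _ a C aP z y zB yB)).
have a1C := reach_col aP R1.
have a1A : col e (A :\: B) (a @: (A :\: B)) a1.
  apply: col_eq aA => x; rewrite inE => /andP[xB _]; exact: reach_out r1 _ xB.
have [E2 [a2 [sE2 leE2 r2 a2E]]] := redA _ _ _ _ a1A bA.
have DBK x : x \in A :\: (A :\: B) -> x \in B.
  by rewrite !inE negb_and negbK => /andP[/orP[//|/negPf->]].
have R2 : reach e A C a1 a2.
  apply: reach_ext r2 => // x y xB /DBK yB _.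
  have /imsetP[w wB aw] := subsetP sE1 _ (a1E.1 y yB).
  by apply/imsetP=> -[z zB /eqP]; rewrite aw (negPf (dis _ a C aP w z wB zB)).
exists (E1 :|: E2), a2; split.
- by rewrite subUset (subset_trans sE1) ?(subset_trans sE2).
- apply: leq_trans (leq_card_setU _ _) _; apply: leq_trans (leq_add leE1 leE2) _.
  have bI : (b @: B) :&: (b @: (A :\: B)) = set0.
    apply/setP=> c; rewrite !inE.
    apply/negP=> /andP[/imsetP[x xB ->] /imsetP[y yB /eqP]].
    by rewrite (negPf (dis _ b D bP x y xB yB)).
  rewrite -cardsUI bI cards0 addn0; apply: subset_leq_card.
  by rewrite subUset sbB.
- exact: reach_trans R2.
split=> [x xA|]; last exact: (reach_col a1C R2).2.
rewrite inE; have [xB|xB] := boolP (x \in B); last by rewrite a2E.1 ?orbT // inE xB.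
by rewrite -(reach_out r2) ?inE ?xB // a1E.1.
Qed.

Lemma indep_triple_free A X : {in X &, forall x y, ~~ e x y} -> X \subset A ->
    {in A & A & A, forall x y z, ~~ [&& co e x y, co e y z & co e x z]} ->
  #|X| <= 2.
Proof.
move=> Xi sXA no; rewrite leqNgt; apply/negP=> /card_gt2P[x [y [z [[xX yX zX] [xy yz zx]]]]].
have := no x y z (subsetP sXA _ xX) (subsetP sXA _ yX) (subsetP sXA _ zX).
by rewrite /co xy yz eq_sym zx !Xi.
Qed.

Lemma card_classes A C a : (forall x, x \in A -> a x \in C) ->
  #|A| = \sum_(c in C) #|[set x in A | a x == c]|.
Proof.
move=> aC; rewrite -sum1_card (partition_big a (mem C)) //=.
apply: eq_bigr => c _; rewrite -sum1_card; apply: eq_bigl => x.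
by rewrite inE.
Qed.

Lemma class_indep A C a c : col e A C a ->
  {in [set x in A | a x == c] &, forall x y, ~~ e x y}.
Proof.
move=> aP x y; rewrite !inE => /andP[xA /eqP ax] /andP[yA /eqP ay].
by apply/negP=> /(aP.2 x y xA yA); rewrite ax ay eqxx.
Qed.

Lemma triple_free_drop A C D a b :
    {in A & A & A, forall x y z, ~~ [&& co e x y, co e y z & co e x z]} ->
    col e A C a -> col e A D b -> #|D| < #|C| ->
  exists c a', [/\ c \in C, reach e A C a a' & col e A (C :\ c) a'].
Proof.
have [n] := ubnP #|A|; elim: n A C D a => // n IH A C D a /ltnSE-leAn no aP bP ltDC.
have [/exists_inP[c cC /forall_inP ac]|/exists_inPn noc] :=
    boolP [exists c in C, forall x in A, a x != c].
  exists c, a; split=> //; first exact: reach_refl.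
  by split=> [x xA|]; [rewrite !inE ac ?aP.1 | apply: aP.2].
(* If no class is a singleton, each colour of [C] has at least two vertices while a class of [b] has
   at most two, so [#|C| * 2 <= #|A| <= #|D| * 2]. *)
have [u uA us] : exists2 u, u \in A & {in A, forall y, a y = a u -> y = u}.
  have [/exists_inP[u uA /forall_inP us]|/exists_inPn nou] :=
      boolP [exists u in A, forall y in A, (a y == a u) ==> (y == u)].
    by exists u => // y yA /eqP ay; apply/eqP; apply: (implyP (us y yA)).
  suff: #|C| * 2 <= #|D| * 2 by rewrite leq_mul2r leqNgt ltDC.
  rewrite -2!sum_nat_const.
  apply: (@leq_trans #|A|).
    rewrite (card_classes aP.1); apply: leq_sum => c cC.
    have /forall_inPn[u uA] := noc c cC; rewrite negbK => /eqP auc.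
    have /forall_inPn[y yA] := nou u uA; rewrite negb_imply => /andP[/eqP ay yu].
    by apply/card_gt1P; exists y, u; rewrite !inE yA uA ay auc eqxx.
  rewrite (card_classes bP.1); apply: leq_sum => d dD.
  apply: indep_triple_free no; first exact: class_indep bP.
  by apply/subsetP=> x; rewrite inE => /andP[].
pose X := [set x in A | b x == b u].
have uX : u \in X by rewrite inE uA eqxx.
have sXA : X \subset A by apply/subsetP=> x; rewrite inE => /andP[].
have Xi : {in X &, forall x y, ~~ e x y} by apply: class_indep bP.
have au y : y \in A :\: X -> a y != a u.
  rewrite inE => /andP[yX yA]; apply: contraNneq yX => /(us y yA)->; exact: uX.
have auC := aP.1 u uA.
have Xf x y : x \in X -> y \in A :\: X -> e x y -> a y != a u by move=> _ /au.
(* Only [u] has colour [a u], so its whole [b]-class can take that colour. *)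
have r1 := recol_reach e_sym aP auC sXA Xi Xf.
set a1 := recol a X (a u) in r1.
have a1C := reach_col aP r1.
have sDA := subsetDl A X.
(* Both palettes lose one colour, so the strict inequality survives on the complement of [X]. *)
have [|||||c [a' [cC r2 a'P]]] := IH (A :\: X) (C :\ a u) (D :\ b u) a1.
- apply: leq_trans leAn; apply: proper_card; rewrite properE sDA.
  by apply/subsetPn; exists u; rewrite // inE uX.
- by move=> x y z /(subsetP sDA) xA /(subsetP sDA) yA /(subsetP sDA); apply: no.
- split=> [x xD|]; last exact: (col_sub sDA (subxx _) a1C).2.
  have axu := au x xD; move: xD; rewrite !inE => /andP[xX xA].
  by rewrite ffunE inE (negPf xX) axu aP.1.
- split=> [x|]; last exact: (col_sub sDA (subxx _) bP).2.
  rewrite !inE => /andP[]; rewrite negb_and => /orP[/negP//|-> xA].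
  exact: bP.1.
- by have := ltDC; rewrite (cardsD1 (b u) D) bP.1 // (cardsD1 (a u) C) auC.
have DXK x : x \in A -> x \notin A :\: X -> x \in X.
  by rewrite inE negb_and negbK => xA; rewrite xA orbF.
have R2 : reach e A C a1 a'.
  apply: reach_ext r2 => //; first exact: subsetDl.
  move=> x y _; rewrite inE => /andP[yD yA] _.
  by rewrite ffunE (DXK y) // !inE eqxx.
move: cC; rewrite !inE => /andP[cau cC].
exists c, a'; split=> //; first exact: reach_trans R2.
split=> [x xA|]; last exact: (reach_col a1C R2).2.
have [xD|xD] := boolP (x \in A :\: X).
  by have := a'P.1 x xD; rewrite !inE => /and3P[-> _ ->].
by rewrite -(reach_out r2) // ffunE (DXK x) // !inE eq_sym cau.
Qed.

Lemma reducible_triple_free A :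
    {in A & A & A, forall x y z, ~~ [&& co e x y, co e y z & co e x z]} ->
  reducible K e A.
Proof.
move=> no C D a b; have [n] := ubnP #|C|.
elim: n C a => // n IH C a /ltnSE-leCn aP bP.
have [leCD|ltDC] := leqP #|C| #|D|.
  by exists C, a; split=> //; apply: reach_refl.
have [c [a1 [cC r1 a1P]]] := triple_free_drop no aP bP ltDC.
have [|E [a2 [sEC leE r2 a2P]]] := IH (C :\ c) a1 _ a1P bP.
  by apply: leq_trans leCn; rewrite [leqRHS](cardsD1 c) cC.
exists E, a2; split=> //; first by rewrite (subset_trans sEC) ?subsetDl.
by apply: reach_trans r1 (reach_sub _ r2); apply: subsetDl.
Qed.

Lemma all_reducible : P4_free e \/ P3P1_free e -> forall A, reducible K e A.
Proof.
move=> free A; have [n] := ubnP #|A|; elim: n A => // n IH A /ltnSE-leAn.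
have red B : B \proper A -> reducible K e B.
  by move=> /proper_card/leq_trans-/(_ _ leAn); apply: IH.
suff : [\/ disc e A, disc (co e) A |
    {in A & A & A, forall x y z, ~~ [&& co e x y, co e y z & co e x z]}].
  case=> [dA|dA|no]; first exact: reducible_union.
    exact: reducible_join.
  exact: reducible_triple_free.
case: free => [P4|P31]; last exact: P3P1_free_disc.
(* The dichotomy for P4-free sets starts at two vertices; smaller sets contain no independent
   triple. *)
have [A1|A1] := leqP #|A| 1; last first.
  by case/orP: (P4_free_disc e_sym e_irr P4 A1); [constructor 1|constructor 2].
constructor 3 => x y z xA yA _; apply/negP=> /and3P[/andP[/eqP xy _] _ _].
by apply: xy; apply: (card_le1_eqP A1).
Qed.

End Reducibility.

(** * Transfer to reconfiguration graphs and the chromatic number *)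

Lemma setT_col (T : finType) (e : rel T) k (a : {ffun T -> 'I_k}) :
  proper_col e a <-> col e setT setT a.
Proof.
split=> [/forallP aP|[_ aP]].
  by split=> // x y _ _ exy; have /forallP/(_ y) := aP x; rewrite exy.
apply/forallP=> x; apply/forallP=> y; apply/implyP; exact: aP.
Qed.

Lemma reach_recol (T : finType) (e : rel T) k (a b : {ffun T -> 'I_k}) :
  proper_col e a -> reach e setT setT a b -> connect (@recol_adj T e k) a b.
Proof.
move=> aP; elim=> // {}b c v ab IH cP _ bc.
have bP : proper_col e b.
  by apply/setT_col; apply: (reach_col _ ab); apply/setT_col.
have {}cP : proper_col e c by apply/setT_col.
(* Idle steps, allowed by [reach], are not edges of [recol_adj]. *)
have [<-//|nbc] := eqVneq b c; apply: connect_trans IH (connect1 _).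
rewrite /recol_adj bP cP /= eqn_leq; apply/andP; split.
  rewrite -(cards1 v); apply: subset_leq_card; apply/subsetP=> x; rewrite !inE.
  by apply: contraNT => /bc->.
apply/card_gt0P; have [/forallP bcE|/forallPn[x bcx]] := boolP [forall x, b x == c x].
  by case/eqP: nbc; apply/ffunP=> x; apply/eqP.
by exists x; rewrite inE.
Qed.

Lemma colourable_card (T : finType) (e : rel T) :
  irreflexive e -> colourable e #|T|.
Proof.
move=> ei; apply/existsP; exists [ffun x => enum_rank x].
apply/forallP=> x; apply/forallP=> y; apply/implyP=> exy; rewrite !ffunE.
by apply: contraTneq exy => /enum_rank_inj->; rewrite ei.
Qed.

Lemma colourable_chi (T : finType) (e : rel T) :
  irreflexive e -> colourable e (chi e).
Proof.
move=> ei; have has_col : has (colourable e) (iota 0 #|T|.+1).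
  by apply/hasP; exists #|T|; [rewrite mem_iota ltnS leqnn | apply: colourable_card].
have := nth_find 0 has_col; rewrite nth_iota //.
by rewrite -[X in _ < X](size_iota 0) -has_find.
Qed.

Lemma chi_min (T : finType) (e : rel T) k :
  k <= #|T| -> colourable e k -> chi e <= k.
Proof.
move=> kT ek; rewrite leqNgt; apply/negP=> ltk.
by have := before_find 0 ltk; rewrite nth_iota // ek.
Qed.

Lemma free_mixing (T : finType) (e : rel T) l :
    simple_graph e -> P4_free e \/ P3P1_free e -> chi e + 1 <= l ->
  mixing e l.
Proof.
move=> [es ei] free; rewrite addn1 => ltl a b aP bP; apply: (reach_recol aP).
have /existsP[d dP] := colourable_chi ei.
(* An optimal colouring is embedded in ['I_l]; its [chi e] colours form [D], which leaves a spare
   one. *)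
pose w := widen_ord (ltnW ltl).
pose D := [set w i | i : 'I_(chi e)].
have w_inj : injective w by move=> i j /(congr1 val) /= /val_inj.
apply: (reducible_mixing es (D := D) (d := [ffun x => w (d x)])).
- exact: all_reducible.
- exact/setT_col.
- exact/setT_col.
- by move=> x; rewrite inE.
- split=> [x _|x y _ _ exy]; rewrite !ffunE; first exact: imset_f.
  rewrite inj_eq //; move/forallP/(_ x)/forallP/(_ y): dP; rewrite exy; exact.
- by rewrite card_imset // cardsT !card_ord.
Qed.

(** * Frozen colourings *)

Lemma induced_sub_trans (T1 T2 T3 : finType) (e1 : rel T1) (e2 : rel T2) (e3 : rel T3) :
  induced_sub e1 e2 -> induced_sub e2 e3 -> induced_sub e1 e3.
Proof.
move=> [f [fi fe]] [g [gi ge]]; exists (g \o f); split; first exact: inj_comp.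
by move=> x y; rewrite fe ge.
Qed.

(** Makes embeddability decidable, so that an embedding can be extracted when the negation [H_free]
    fails. *)
Lemma induced_subP (T1 T2 : finType) (e1 : rel T1) (e2 : rel T2) :
  reflect (induced_sub e1 e2)
    [exists f : {ffun T1 -> T2}, injectiveb f &&
       [forall x, forall y, e1 x y == e2 (f x) (f y)]].
Proof.
apply: (iffP existsP) => [[f /andP[/injectiveP fi /forallP fe]]|[f [fi fe]]].
  by exists f; split=> // x y; apply/eqP; move: y; apply/forallP.
exists (finfun f); apply/andP; split.
  by apply/injectiveP=> x y; rewrite !ffunE => /fi.
by apply/forallP=> x; apply/forallP=> y; rewrite !ffunE fe.
Qed.

Lemma P4_free_of (T : finType) (e : rel T) :
  simple_graph e -> ~ induced_sub (@path_rel 4) e -> P4_free e.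
Proof.
move=> [es ei] nP a b c d ab bc cd ac ad bd; apply: nP.
have nac : a != c by apply: contraNneq ad => ->.
have nad : a != d by apply: contraNneq bd => <-; rewrite es.
have nbd : b != d by apply: contraNneq ad => <-.
have ne x y : e x y -> x != y by apply: contraTneq => ->; rewrite ei.
have u : uniq [:: a; b; c; d].
  by rewrite /= !inE !negb_or nac nad nbd !ne.
exists (fun i : 'I_4 => nth a [:: a; b; c; d] i); split.
  by move=> i j /eqP; rewrite nth_uniq // => /eqP/val_inj.
have [ba cb dc] : [/\ e b a, e c b & e d c] by split; rewrite es.
have [ca da db] : [/\ ~~ e c a, ~~ e d a & ~~ e d b] by split; rewrite es.
by do 2!case=> [[|[|[|[|//]]]] ?]; rewrite /path_rel /=
  ?(ei, ab, bc, cd, ba, cb, dc, negPf ca, negPf da, negPf db, negPf ac, negPf ad, negPf bd).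
Qed.

Lemma P3P1_free_of (T : finType) (e : rel T) :
  simple_graph e -> ~ induced_sub P3P1 e -> P3P1_free e.
Proof.
move=> [es ei] nP a b c d ab bc nac ac da db dc; apply: nP.
have nda : d != a by apply: contraNneq db => ->.
have ndb : d != b by apply: contraNneq da => ->; rewrite es.
have ndc : d != c by apply: contraNneq db => ->; rewrite es.
have ne x y : e x y -> x != y by apply: contraTneq => ->; rewrite ei.
have u : uniq [:: a; b; c].
  by rewrite /= !inE !negb_or nac !ne.
pose f (x : 'I_3 + 'I_1) := if x is inl i then nth a [:: a; b; c] i else d.
have fd i : d != f (inl i) by case: i => [[|[|[|//]]] ?].
exists f; split.
  move=> [i|i] [j|j] /eqP; rewrite ?[i]ord1 ?[j]ord1 //.
  - by rewrite nth_uniq // => /eqP/val_inj->.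
  - by rewrite eq_sym (negPf (fd i)).
  - by rewrite (negPf (fd j)).
move=> [i|i] [j|j]; rewrite /P3P1 /= ?[i]ord1 ?[j]ord1 /path_rel ?ei //.
- have [ba cb ca] : [/\ e b a, e c b & ~~ e c a] by split; rewrite es.
  by case: i => [[|[|[|//]]] ?]; case: j => [[|[|[|//]]] ?];
    rewrite /= ?(ei, ab, bc, ba, cb, negPf ca, negPf ac).
- by case: i => [[|[|[|//]]] ?] /=; rewrite es ?(negPf da) ?(negPf db) ?(negPf dc).
- by case: j => [[|[|[|//]]] ?] /=; rewrite ?(negPf da) ?(negPf db) ?(negPf dc).
Qed.

(** Each vertex sees every colour but its own, so [a] is an isolated vertex of the reconfiguration
    graph. *)
Lemma frozen_not_mixing (T : finType) (e : rel T) k (a b : {ffun T -> 'I_k}) :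
    proper_col e a -> proper_col e b -> a != b ->
    (forall v c, c != a v -> exists2 w, e v w & a w = c) ->
  ~ mixing e k.
Proof.
move=> aP bP nab frozen mix; case/eqP: nab.
have /connectP[[|c p] /= pth ->] := mix a b aP bP; first by [].
case/andP: pth => /and3P[_ cP /cards1P[v avc]] _.
have acv x : (a x != c x) = (x == v) by rewrite -in_set1 -avc inE.
have cva : c v != a v by rewrite eq_sym acv.
have [w evw awc] := frozen v (c v) cva.
have wv : w != v by apply: contraNneq cva => wv; rewrite -awc wv.
have /eqP aw : a w == c w by apply: negbFE; rewrite acv (negPf wv).
by move/forallP/(_ v)/forallP/(_ w): cP; rewrite evw -aw awc eqxx.
Qed.

Lemma allP_iota (n : nat) (P : nat -> bool) : all P (iota 0 n) -> forall i : 'I_n, P i.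
Proof. by move=> /allP H i; apply: H; rewrite mem_iota ltn_ord. Qed.

(* The Boolean condition, meant to be computed, says that [a] is a frozen
   [k.+1]-colouring and [b] a [k]-colouring of the graph [r] on ['I_n]. *)
Lemma frozen_witness (TH : finType) (eH : rel TH) n k (r : rel nat) (a b : nat -> nat) :
    (forall (TG : finType) (eG : rel TG), simple_graph eG -> H_free eH eG ->
       forall l : nat, chi eG + 1 <= l -> mixing eG l) ->
    [&& 1 < k <= n,
        all (fun i => [&& ~~ r i i, a i < k.+1 & b i < k]) (iota 0 n),
        all (fun i => all (fun j => (r i j == r j i) &&
           (r i j ==> (a i != a j) && (b i != b j))) (iota 0 n)) (iota 0 n) &
        all (fun i => all (fun c => (c != a i) ==>
           has (fun j => r i j && (a j == c)) (iota 0 n)) (iota 0 k.+1)) (iota 0 n)] ->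
  induced_sub eH (fun i j : 'I_n => r i j).
Proof.
move=> mixH /and4P[/andP[k1 kn] /allP_iota h1 /allP_iota h2 /allP_iota h3].
set e := fun i j : 'I_n => r i j.
have [//|nH] := induced_subP eH e.
have h2' (i j : 'I_n) := allP_iota (h2 i) j.
have es : symmetric e by move=> i j; case/andP: (h2' i j) => /eqP.
have ei : irreflexive e by move=> i; case/and3P: (h1 i) => /negPf.
have aK (i : 'I_n) : a i < k.+1 by case/and3P: (h1 i).
have bK (i : 'I_n) : b i < k by case/and3P: (h1 i).
have ek : colourable e k.
  apply/existsP; exists [ffun i => Ordinal (bK i)].
  apply/forallP=> i; apply/forallP=> j; apply/implyP=> eij; rewrite !ffunE.
  by case/andP: (h2' i j) => _ /implyP/(_ eij)/andP[].
have chik : chi e + 1 <= k.+1 by rewrite addn1 ltnS chi_min // card_ord.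
have mix := mixH _ e (conj es ei) nH _ chik.
pose a' := [ffun i => Ordinal (aK i)].
have aP : proper_col e a'.
  apply/forallP=> i; apply/forallP=> j; apply/implyP=> eij; rewrite !ffunE.
  by case/andP: (h2' i j) => _ /implyP/(_ eij)/andP[].
have fr v c : c != a' v -> exists2 w, e v w & a' w = c.
  rewrite ffunE => cv; have := allP_iota (h3 v) c.
  move: cv; rewrite -val_eqE /= => -> /hasP[j].
  rewrite mem_iota => jn /andP[rvj /eqP ajc]; exists (Ordinal jn) => //.
  by rewrite ffunE; apply: val_inj.
pose b' := [ffun i => widen_ord (leqnSn k) (Ordinal (bK i))].
have bP : proper_col e b'.
  apply/forallP=> i; apply/forallP=> j; apply/implyP=> eij; rewrite !ffunE.
  by case/andP: (h2' i j) => _ /implyP/(_ eij)/andP[].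
suff nab : a' != b' by case: (frozen_not_mixing aP bP nab fr mix).
(* [b'] never uses the top colour, but [a'] does, since any vertex has or sees every colour under
   [a']. *)
have i0 : 'I_n by exists 0; lia.
apply/eqP=> ab; have bl (i : 'I_n) : a' i != ord_max.
  by rewrite ab ffunE -val_eqE /= neq_ltn bK.
have [|w _ aw] := fr i0 ord_max; first by rewrite eq_sym bl.
by have := bl w; rewrite aw eqxx.
Qed.

(** * The two witness graphs, and induced subgraphs of the six-cycle *)

Definition cycle6 : rel nat := fun i j => (i.+1 %% 6 == j) || (j.+1 %% 6 == i).

(* The flags (incident vertex-edge pairs) of the diamond K4 - e: flag [i] has
   edge [i./2] and vertex [diamond_end i]. Colouring by edges is frozen, colouring by vertices saves a
   colour, and there is no induced 2K2 because the diamond has no double edge. *)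
Definition diamond_end (i : nat) := nth 0 [:: 0; 1; 0; 2; 0; 3; 1; 2; 1; 3] i.

Definition diamond_flags : rel nat :=
  fun i j => (i./2 != j./2) && (diamond_end i != diamond_end j).

Lemma diamond_flags_2K2_free a b c d (r := diamond_flags) :
    a < 10 -> b < 10 -> c < 10 -> d < 10 ->
  ~~ [&& r a b, r c d, ~~ r a c, ~~ r a d, ~~ r b c & ~~ r b d].
Proof.
move=> a10 b10 c10 d10.
have chk : all (fun a => all (fun b => r a b ==> all (fun c => all (fun d =>
    ~~ [&& r c d, ~~ r a c, ~~ r a d, ~~ r b c & ~~ r b d])
      (iota 0 10)) (iota 0 10)) (iota 0 10)) (iota 0 10) by vm_compute.
have nI x : x < 10 -> x \in iota 0 10 by rewrite mem_iota.
apply/negP=> /andP[rab rcd].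
have chkab := implyP (allP (allP chk a (nI _ a10)) b (nI _ b10)) rab.
by have := allP (allP chkab c (nI _ c10)) d (nI _ d10); rewrite rcd.
Qed.

(** Deleting two consecutive vertices from the six-cycle leaves a P4. *)
Lemma cycle6_P4 (T : finType) (e : rel T) (f : T -> 'I_6) j :
    injective f -> (forall x y, e x y = cycle6 (f x) (f y)) -> j < 6 ->
    (forall x, f x != j :> nat) -> (forall x, f x != j.+1 %% 6 :> nat) ->
  induced_sub e (@path_rel 4).
Proof.
move=> fi fe j6 f0 f1.
(* The rotation taking [j + 2] to 0; writing 10 for 4 keeps the subtraction from truncating. *)
pose g i := (i + 10 - j) %% 6.
have chk : all (fun j => all (fun x => all (fun y =>
  [&& x != j, x != j.+1 %% 6, y != j & y != j.+1 %% 6] ==>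
  let g i := (i + 10 - j) %% 6 in
  [&& g x < 4, g y < 4, (g x == g y) == (x == y) &
   cycle6 x y == ((g x).+1 == g y) || ((g y).+1 == g x)])
  (iota 0 6)) (iota 0 6)) (iota 0 6) by vm_compute.
have key x y : [&& g (f x) < 4, g (f y) < 4, (g (f x) == g (f y)) == (f x == f y :> nat) &
   cycle6 (f x) (f y) == ((g (f x)).+1 == g (f y)) || ((g (f y)).+1 == g (f x))].
  have nI i : i < 6 -> i \in iota 0 6 by rewrite mem_iota.
  have := allP (allP (allP chk j (nI _ j6)) _ (nI _ (ltn_ord (f x)))) _ (nI _ (ltn_ord (f y))).
  by rewrite !f0 !f1.
exists (fun x => inord (g (f x))); split=> x y.
  case/and4P: (key x y) => gx gy /eqP gxy _ /(congr1 val) /=.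
  by rewrite !inordK // => /eqP; rewrite gxy => /eqP/val_inj/fi.
by case/and4P: (key x y) => gx gy _ /eqP; rewrite fe /path_rel !inordK.
Qed.

(** Modulo 6, deleting [j] and [j + 2] isolates [j + 1] and leaves the path [j + 3], [j + 4],
    [j + 5]. *)
Lemma cycle6_P3P1 (T : finType) (e : rel T) (f : T -> 'I_6) j :
    injective f -> (forall x y, e x y = cycle6 (f x) (f y)) -> j < 6 ->
    (forall x, f x != j :> nat) -> (forall x, f x != (j + 2) %% 6 :> nat) ->
  induced_sub e P3P1.
Proof.
move=> fi fe j6 f0 f1.
(* This rotation sends the path to 0, 1, 2 and the isolated vertex to 4. *)
pose g i := (i + 9 - j) %% 6.
have chk : all (fun j => all (fun x => all (fun y =>
  [&& x != j, x != (j + 2) %% 6, y != j & y != (j + 2) %% 6] ==>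
  let g i := (i + 9 - j) %% 6 in
  [&& (g x < 3) || (g x == 4), (g y < 3) || (g y == 4), (g x == g y) == (x == y) &
   cycle6 x y == [&& g x < 3, g y < 3 & ((g x).+1 == g y) || ((g y).+1 == g x)]])
  (iota 0 6)) (iota 0 6)) (iota 0 6) by vm_compute.
have key x y : [&& (g (f x) < 3) || (g (f x) == 4), (g (f y) < 3) || (g (f y) == 4),
    (g (f x) == g (f y)) == (f x == f y :> nat) &
    cycle6 (f x) (f y) == [&& g (f x) < 3, g (f y) < 3 &
      ((g (f x)).+1 == g (f y)) || ((g (f y)).+1 == g (f x))]].
  have nI i : i < 6 -> i \in iota 0 6 by rewrite mem_iota.
  have := allP (allP (allP chk j (nI _ j6)) _ (nI _ (ltn_ord (f x)))) _ (nI _ (ltn_ord (f y))).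
  by rewrite !f0 !f1.
pose h x : 'I_3 + 'I_1 := if g (f x) < 3 then inl (inord (g (f x))) else inr ord0.
exists h; split=> x y; case/and4P: (key x y) => gx gy /eqP gxy /eqP; rewrite /h.
  move=> _; case: ifP gx => gx3 gx; case: ifP gy => gy3 gy //.
    by case=> /(congr1 val) /=; rewrite !inordK // => /eqP; rewrite gxy => /eqP/val_inj/fi.
  by move=> _; apply/fi/val_inj/eqP; rewrite /= -gxy (eqP gx) (eqP gy).
rewrite fe => ->; case: ifP => gx3; case: ifP => gy3 //=.
by rewrite /path_rel !inordK.
Qed.

Theorem theorem3 (TH : finType) (eH : rel TH) (HH : simple_graph eH) :
  (forall (TG : finType) (eG : rel TG), simple_graph eG -> H_free eH eG ->
     forall l : nat, chi eG + 1 <= l -> mixing eG l)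
  <-> (induced_sub eH (@path_rel 4) \/ induced_sub eH P3P1).
Proof.
split=> [mixH|subH TG eG sG Hfree l]; last first.
  apply: free_mixing => //; case: subH => sub; [left | right].
    by apply: P4_free_of => // P4; apply: Hfree; apply: induced_sub_trans P4.
  by apply: P3P1_free_of => // P31; apply: Hfree; apply: induced_sub_trans P31.
(* Residues modulo 3 are a frozen colouring of the six-cycle and residues modulo 2 a smaller one. *)
have [f [fi fe]] := @frozen_witness TH eH 6 2 cycle6 (modn^~ 3) (modn^~ 2) mixH isT.
have [g [gi ge]] :=
  @frozen_witness TH eH 10 4 diamond_flags half diamond_end mixH isT.
pose s i := [exists x, f x == i :> nat].
have sN i : ~~ s i -> forall x, f x != i :> nat by move/existsPn.
(* Opposite edges of the six-cycle form an induced 2K2, which [g] would carry into the flag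
   graph. *)
have no2K2 i : i < 3 -> ~~ [&& s i, s i.+1, s i.+3 & s ((i + 4) %% 6)].
  move=> i3; apply/negP=> /and4P[/existsP[a /eqP fa] /existsP[b /eqP fb]].
  move=> /existsP[c /eqP fc] /existsP[d /eqP fd].
  have := diamond_flags_2K2_free (ltn_ord (g a)) (ltn_ord (g b))
                                 (ltn_ord (g c)) (ltn_ord (g d)).
  rewrite /= -!ge !fe fa fb fc fd.
  by move: i3 {fa fb fc fd}; case: i => [|[|[|//]]].
(* By [no2K2] the vertices missed by [f] do not all lie in one antipodal pair, so two of them are at
   distance 1 or 2. *)
have [[j j6 /andP[sj sj1]]|[j j6 /andP[sj sj2]]] :
    (exists2 j, j < 6 & ~~ s j && ~~ s (j.+1 %% 6)) \/
    (exists2 j, j < 6 & ~~ s j && ~~ s ((j + 2) %% 6)).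
- suff: has (fun j => ~~ s j && ~~ s (j.+1 %% 6)) (iota 0 6) ||
        has (fun j => ~~ s j && ~~ s ((j + 2) %% 6)) (iota 0 6).
    by case/orP=> /hasP[j]; rewrite mem_iota => j6 sj; [left|right]; exists j.
  move: (no2K2 0 isT) (no2K2 1 isT) (no2K2 2 isT); clearbody s.
  vm_compute.
  by case: (s 0); case: (s 1); case: (s 2); case: (s 3); case: (s 4); case: (s 5).
- by left; apply: (cycle6_P4 fi fe j6); apply: sN.
- by right; apply: (cycle6_P3P1 fi fe j6); apply: sN.
Qed.
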